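(* Suppose $(X, \tau, <)$ is a locally countably compact GO-space. Then $X$ is monotonically metacompact if and only if $(X, \tau)$ is metrizable, and $X$ is monotonically countably metacompact if and only if $(X,\tau)$ is metrizable.
   Context: A GO-space (generalized ordered space) is a triple $(X, \tau, <)$ where $<$ is a linear ordering of the set $X$ and $\tau$ is a Hausdorff topology on $X$ that has a base of convex subsets of $(X,<)$, possibly including some singletons. A space is locally countably compact if each point has a countably compact neighborhood. For two collections of sets $\mathcal{U}$ and $\mathcal{V}$, write $\mathcal{U} \prec \mathcal{V}$ if for each $U \in \mathcal{U}$ there is some $V \in \mathcal{V}$ with $U \subseteq V$. A space $X$ is monotonically metacompact (respectively, monotonically countably metacompact), in the sense of Popvassilev, if there is a function $r$ that associates with each open cover (respectively, each countable open cover) $\mathcal{U}$ of $X$ a point-finite collection $r(\mathcal{U})$ of open sets that covers $X$ and satisfies $r(\mathcal{U}) \prec \mathcal{U}$, in such a way that if $\mathcal{U}$ and $\mathcal{V}$ are open covers (respectively, countable open covers) of $X$ with $\mathcal{U} \prec \mathcal{V}$, then $r(\mathcal{U}) \prec r(\mathcal{V})$. (In the countable version, $r(\mathcal{U})$ is not required to be countable.) *)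

(* Defs.v *)
From HB Require Import structures.
From mathcomp Require Import all_boot all_order all_algebra.
From mathcomp Require Import all_classical all_reals topology.

Set Implicit Arguments.
Unset Strict Implicit.
Unset Printing Implicit Defensive.

Import Order.TTheory GRing.Theory Num.Theory.

Local Open Scope classical_set_scope.
Local Open Scope ring_scope.

Definition order_convex d (T : porderType d) (C : set T) : Prop :=
  forall x y z : T, C x -> C y -> (x <= z <= y)%O -> C z.

(* The library has no join of [topologicalType] and [orderType] other than
   [orderTopologicalType], whose topology is the one generated by the open
   intervals; the topology of a GO-space may be strictly finer. Hence the order
   of [X] is only bundled as a partial order and is required to be total here. *)
Definition go_space d (X : POrderedTopological.type d) : Prop :=
  [/\ total (<=%O : rel X),
      hausdorff_space X &
      exists2 B : set (set X), basis B & forall C, B C -> order_convex C].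

Section covering_properties.
Context {X : topologicalType}.
Implicit Types (U V : set (set X)) (A : set X).

Definition countably_compact A : Prop :=
  forall U, countable U -> U `<=` open -> A `<=` cover U id ->
    finite_subset_cover U id A.

Definition locally_countably_compact : Prop :=
  forall x : X, exists2 K, nbhs x K & countably_compact K.

Definition refines U V : Prop :=
  forall A, U A -> exists2 B, V B & A `<=` B.

Definition open_cover U : Prop := U `<=` open /\ cover U id = [set: X].

Definition countable_open_cover U : Prop := open_cover U /\ countable U.

Definition point_finite U : Prop :=
  forall x : X, finite_set [set A | U A /\ A x].

(* [P] selects the class of covers on which the operator [r] has to behave;
   the values of [r] outside of [P] are irrelevant. *)
Definition monotone_metacompactness_operator (P : set (set (set X)))
    (r : set (set X) -> set (set X)) : Prop :=
  (forall U, P U ->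
     [/\ open_cover (r U), point_finite (r U) & refines (r U) U]) /\
  (forall U V, P U -> P V -> refines U V -> refines (r U) (r V)).

End covering_properties.

Arguments locally_countably_compact X : clear implicits.

Definition monotonically_metacompact (X : topologicalType) : Prop :=
  exists r, monotone_metacompactness_operator (@open_cover X) r.

Definition monotonically_countably_metacompact (X : topologicalType) : Prop :=
  exists r, monotone_metacompactness_operator (@countable_open_cover X) r.

(* The axioms of a metric are those of the factory [isMetric]. *)
Definition is_metric (R : realType) (T : Type) (rho : T -> T -> R) : Prop :=
  [/\ forall x, rho x x = 0,
      forall x y, rho x y = 0 -> x = y,
      forall x y, rho x y = rho y x &
      forall y x z, rho x z <= rho x y + rho y z].

Definition metrizable (R : realType) (X : topologicalType) : Prop :=
  exists2 rho : X -> X -> R, is_metric rho &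
    forall x : X, nbhs x = nbhs_ball_ (fun y e => [set z | rho y z < e]) x.

(* Main.v *)
(** A metric space has a sequence [G n] of point-finite open covers of mesh
    tending to 0, each refining the previous one; sending an open cover to the
    earliest members of this sequence that lie in a member of the cover is a
    monotone metacompactness operator.

    Conversely let [r] be a monotone operator on countable covers. For [a < b]
    it is applied to the cover by the rays [z < b] and [a < z], and [reach g a b]
    says that a member of the image contains all of [[g, a]]. For fixed [g] there
    is no infinite chain [s 0 < s 1 < ...] with [reach g (s n) (s n.+1)]. This
    yields, first, countable cofinality of every set in which bounded increasing
    sequences have limits, and then, by closing a point under countably many
    choices, a countable set meeting every nondegenerate subsegment of a
    countably compact segment. Call two points equivalent when the segment
    between them is countably compact: the classes are open and convex, and by
    the two facts above second countable. So they are locally compact and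
    metrizable, and the space is their topological sum. *)

Require Import Defs.
From HB Require Import structures.
From mathcomp Require Import all_boot all_order all_algebra finmap lra.
From mathcomp Require Import all_classical all_reals topology normedtype.
From mathcomp Require Import wochoice.

Set Implicit Arguments.
Unset Strict Implicit.
Unset Printing Implicit Defensive.

Import Order.TTheory GRing.Theory Num.Theory.
Import numFieldTopology.Exports.

Local Open Scope ring_scope.
Local Open Scope classical_set_scope.

(** * Metric spaces are monotonically metacompact *)

(** Antisymmetry is the uniqueness of the least element of the pair [a], [b]. *)
Lemma well_order_least (T : eqType) : exists R : rel T,
  (forall A : set T, A !=set0 -> exists2 a, A a & forall b, A b -> R a b) /\
  (forall a b, R a b -> R b a -> a = b).
Proof.
have [R wR] := well_ordering_principle T; exists R.
have least (A : set T) : A !=set0 -> exists2 a, A a & forall b, A b -> R a b.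
  move=> [a Aa]; have [|b [[bA bmin] _]] := wR [pred x | `[< A x >]].
    by exists a; apply/asboolP.
  by exists b; [exact/asboolP|move=> c Ac; apply: bmin; exact/asboolP].
have refl a : R a a by have [|_ -> H] := least [set a]; [exists a|exact: H].
split => // a b ab ba; have [|z [_ zu]] := wR (pred2 a b).
  by exists a; rewrite inE eqxx.
rewrite -(zu a) ?(zu b)//.
  by split=> [|x]; rewrite !inE ?eqxx ?orbT// => /orP[] /eqP->.
by split=> [|x]; rewrite !inE ?eqxx ?orbT// => /orP[] /eqP->.
Qed.

Section metric_metacompact.
Context {R : realType} {T : topologicalType} (rho : T -> T -> R).
Hypothesis rho_metric : is_metric rho.
Hypothesis nbhs_rho :
  forall x, nbhs x = nbhs_ball_ (fun y e => [set z | rho y z < e]) x.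
Implicit Types (x y z : T) (A V W G H : set T) (U : set (set T)).

Let mball x (e : R) := [set z | rho x z < e].

Let rhoxx x : rho x x = 0. Proof. by case: rho_metric. Qed.

Let rhoC x y : rho x y = rho y x. Proof. by case: rho_metric. Qed.

Let rho_triangle y x z : rho x z <= rho x y + rho y z.
Proof. by case: rho_metric. Qed.

Let open_mball x e : open (mball x e).
Proof.
rewrite openE => y xy; rewrite /interior nbhs_rho; exists (e - rho x y) => /=.
  by rewrite subr_gt0.
by move=> z /= yz; rewrite /mball/= (le_lt_trans (rho_triangle y _ _))// -ltrBrDl.
Qed.

Let mball_open A x : open A -> A x -> exists2 e, 0 < e & mball x e `<=` A.
Proof.
by move=> oA Ax; have := open_nbhs_nbhs (conj oA Ax); rewrite nbhs_rho.
Qed.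

Let radius n : R := n.+1%:R^-1.

Let radius_gt0 n : 0 < radius n. Proof. by rewrite invr_gt0. Qed.

Let radius_le m n : (m <= n)%N -> radius n <= radius m.
Proof. by move=> mn; rewrite lef_pV2 ?posrE// ler_nat. Qed.

Let radius_lt e : 0 < e -> exists n, radius n < e.
Proof.
move=> e0; exists (Num.truncn e^-1); rewrite /radius invf_plt ?posrE//.
by rewrite truncnS_gt.
Qed.

(* M. E. Rudin's proof of Stone's theorem, reduced to point-finiteness. *)
Lemma metric_point_finite_refinement U : open_cover U ->
  exists U', [/\ open_cover U', point_finite U' & refines U' U].
Proof.
move=> [oU cU]; have [lew [lewP lew_anti]] := well_order_least (set T).
have least x : {V | U V /\ V x & forall W, U W -> W x -> lew V W}.
  apply: cid2; have [|V [UV Vx] minV] := lewP [set V | U V /\ V x].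
    by have : setT x by []; rewrite -cU => -[V UV Vx]; exists V.
  by exists V => // W UW Wx; exact: minV.
pose fst_ x := s2val (least x).
have fstU x : U (fst_ x) by have [] := s2valP (least x).
have fstx x : fst_ x x by have [] := s2valP (least x).
have fst_le x W : U W -> W x -> lew (fst_ x) W by exact: (s2valP' (least x)).
(* If balls of one stage for [V] and [W] meet, their centers are less than twice the radius apart,
   so each center lies in both sets. Each center has its own set as first member of [U], hence
   [V = W]; this is [D1]. *)
pose stage (E : set T) V n := \bigcup_(x in
  [set x | [/\ fst_ x = V, ~ E x & mball x (radius n *+ 2) `<=` V]])
  mball x (radius n).
pose E := fix E n := if n is m.+1
  then E m `|` \bigcup_V stage (E m) V m else set0.
pose D V n := stage (E n) V n.
have oD V n : open (D V n) by apply: bigcup_open => x _; exact: open_mball.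
have DE V n m : (n < m)%N -> D V n `<=` E m.
  elim: m => // m IH; rewrite ltnS leq_eqVlt => /orP[/eqP->|/IH nm] x Dx.
    by right; exists V.
  by left; exact: nm.
have ED m x : E m x -> exists V n, D V n x.
  by elim: m => // m IH [/IH//|[V _ Dx]]; exists V, m.
have fstD V n x : D V n x -> U V by move=> [y [<- _ _] _].
exists [set A | exists V n, U V /\ A = D V n]; split.
- split; first by move=> _ [V [n [_ ->]]].
  apply/seteqP; split => // x _.
  suff [V [n Dx]] : exists V n, D V n x.
    by exists (D V n) => //; exists V, n; split => //; exact: fstD Dx.
  have [e e0 ex] := mball_open (oU _ (fstU x)) (fstx x).
  have [n ne] : exists n, radius n < e / 2 by apply: radius_lt; rewrite divr_gt0.
  have [/ED//|nEx] := pselect (E n x); exists (fst_ x), n, x.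
    split => // y xy; apply: ex; apply: (lt_trans xy).
    by rewrite -mulr_natr -ltr_pdivlMr.
  by rewrite /mball/= rhoxx.
- move=> x.
  (* A ball of radius [e] about [x] that is absorbed at stage [n] contains no center of a later
     stage, so [x] is in no set of a stage [i > n] with [radius i <= e]. *)
  have [m Dm] : exists m, forall V n, D V n x -> (n < m)%N.
    have [[V [n Dx]]|nD] := pselect (exists V n, D V n x); last first.
      by exists 0%N => V n Dx; exfalso; apply: nD; exists V, n.
    have [e e0 ex] := mball_open (oD V n) Dx.
    have [k ke] := radius_lt e0; exists (maxn k n.+1) => W i [y [_ nEy _] yx].
    rewrite ltnNge; apply/negP; rewrite geq_max => /andP[ki ni]; apply: nEy.
    apply: (DE V n) => //; apply: ex; rewrite /mball/= rhoC.
    exact: lt_le_trans yx (le_trans (radius_le ki) (ltW ke)).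
  have D1 V W n : D V n x -> D W n x -> V = W.
    have half V' W' : D V' n x -> D W' n x -> lew W' V'.
      move=> DV [z [<- _ _] zx]; have UV := fstD _ _ _ DV.
      case: DV => y [_ _ yV] yx; apply: fst_le => //.
      apply: yV; rewrite /mball/= (le_lt_trans (rho_triangle x _ _))//.
      by rewrite mulr2n ltrD// rhoC.
    by move=> DV DW; apply: lew_anti; apply: half.
  have pick n : {A | forall V, D V n x -> A = D V n}.
    apply: cid; have [[V DV]|nV] := pselect (exists V, D V n x).
      by exists (D V n) => W DW; rewrite (D1 _ _ _ DV DW).
    by exists set0 => V DV; exfalso; apply: nV; exists V.
  apply: (@sub_finite_set _ _ ((fun n => sval (pick n)) @` `I_m)).
    move=> _ [[V [n [_ ->]]] DV]; exists n; first exact: Dm DV.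
    exact: (svalP (pick n)).
  exact/finite_image/finite_II.
move=> _ [V [n [UV ->]]]; exists V => // x [y [_ _ yV] yx]; apply: yV.
by rewrite /mball/= (lt_le_trans yx)// mulr2n lerDl ltW.
Qed.

(** Stage [n] is a common refinement of point-finite refinements of the covers by balls of radius
    [radius 0] to [radius n]; two points of one member are less than [2 * radius n] apart. *)
Lemma metric_development : exists G : nat -> set (set T),
  [/\ forall n, open_cover (G n) /\ point_finite (G n),
    forall m n, (m <= n)%N -> refines (G n) (G m) &
    forall V x, open V -> V x ->
      exists n, forall A, G n A -> A x -> A `<=` V].
Proof.
have fine n : {U | [/\ open_cover U, point_finite U &
    refines U (range (fun x => mball x (radius n)))]}.
  apply/cid/metric_point_finite_refinement; split.
    by move=> _ [x _ <-]; exact: open_mball.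
  apply/seteqP; split => // x _; exists (mball x (radius n)); first by exists x.
  by rewrite /mball/= rhoxx.
pose F n := sval (fine n).
pose meet U U' := (fun AB => AB.1 `&` AB.2) @` (U `*` U').
pose G := fix G n := if n is m.+1 then meet (G m) (F n) else F 0%N.
have GF n : refines (G n) (F n).
  case: n => [|n] A; first by exists A.
  by move=> [[B C] [_ FC] <-]; exists C.
exists G; split.
- elim=> [|n [[oG cG] fG]]; first by have [] := svalP (fine 0%N).
  have [[oF cF] fF _] := svalP (fine n.+1); split; first split.
  + by move=> _ [[A B] [GA FB] <-]; apply: openI; [exact: oG|exact: oF].
  + apply/seteqP; split => // x _.
    have : setT x by []; rewrite -{1}cG => -[A GA Ax].
    have : setT x by []; rewrite -{1}cF => -[B FB Bx].
    by exists (A `&` B) => //; exists (A, B).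
  + move=> x; apply: (@sub_finite_set _ _ (meet [set A | G n A /\ A x]
        [set B | F n.+1 B /\ B x])).
      by move=> _ [[[A B] [GA FB] <-] [Ax Bx]]; exists (A, B).
    by apply/finite_image/finite_setX; [exact: fG|exact: fF].
- move=> m; elim=> [|n IH]; first by rewrite leqn0 => /eqP-> A; exists A.
  rewrite leq_eqVlt => /orP[/eqP-> A|/IH{}IH _ [[A B] [GA _] <-]]; first by exists A.
  by have [C GC AC] := IH A GA; exists C => // x [/AC].
move=> V x oV Vx; have [e e0 eV] := mball_open oV Vx.
have [n ne] : exists n, radius n < e / 2 by apply: radius_lt; rewrite divr_gt0.
exists n => A GA Ax z Az; apply: eV.
have [B FB AB] := GF n A GA; have [_ _ rF] := svalP (fine n).
have [_ [y _ <-] By] := rF B FB.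
have yx : rho y x < radius n by apply: By; exact: AB.
have yz : rho y z < radius n by apply: By; exact: AB.
by rewrite /mball/=; have := rho_triangle y x z; rewrite (rhoC x y); lra.
Qed.

(* The image of a cover [U] consists of the members of the development that lie
   in a member of [U] and in no such member of an earlier stage. *)
Lemma metric_monotonically_metacompact : monotonically_metacompact T.
Proof.
have [G [GP Gr Gd]] := metric_development.
pose inside U A := exists2 V, U V & A `<=` V.
pose r U := [set A | exists n, [/\ G n A, inside U A &
  forall m B, (m < n)%N -> G m B -> A `<=` B -> ~ inside U B]].
(* A member [B] taken at the earliest possible stage qualifies for [r U]: a larger set inside [U] at
   an earlier stage would also contain [A]. Covering and monotonicity both come from this. *)
have r_above U n A : G n A -> inside U A -> exists2 B, r U B & A `<=` B.
  move=> GA UA; pose P k := `[< exists B, [/\ G k B, A `<=` B & inside U B] >].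
  have exP : exists k, P k by exists n; apply/asboolP; exists A; split.
  have [k /asboolP[B [GB AB UB]] kmin] := ex_minnP exP.
  exists B => //; exists k; split => // m C mk GC BC UC.
  have : (k <= m)%N.
    by apply/kmin/asboolP; exists C; split => //; exact: subset_trans BC.
  by rewrite leqNgt mk.
exists r; split.
  move=> U [oU cU].
  have star x : exists n, forall A, G n A -> A x -> inside U A.
    have : setT x by []; rewrite -{1}cU => -[V UV Vx].
    have [n nV] := Gd V x (oU V UV) Vx.
    by exists n => A GA Ax; exists V => //; exact: nV.
  split.
  - split; first by move=> A [n [GA _ _]]; exact: (GP n).1.1.
    apply/seteqP; split => // x _; have [n nU] := star x.
    have : setT x by []; rewrite -{1}(GP n).1.2 => -[A GA Ax].
    by have [B rB AB] := r_above U n A GA (nU A GA Ax); exists B => //; exact: AB.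
  (* A member of [r U] through [x] from a stage after [n] would lie in a member of [G n] through
     [x], which is inside [U]; so only the stages up to [n] contribute. *)
  - move=> x; have [n nU] := star x.
    apply: (@sub_finite_set _ _ (\bigcup_(k in `I_n.+1) [set A | G k A /\ A x])).
      move=> A [[k [GA UA Amin]] Ax]; exists k => //=.
      rewrite ltnS leqNgt; apply/negP => nk.
      have [B GB AB] := Gr n k (ltnW nk) A GA.
      by apply: (Amin n B nk GB AB); apply: nU => //; exact: AB.
    by apply: bigcup_finite => [|k _]; [exact: finite_II|exact: (GP k).2].
  - by move=> A [n [_ [V UV AV] _]]; exists V.
move=> U U' _ _ UU' A [n [GA [V UV AV] _]]; apply: (r_above _ n) => //.
by have [V' UV' VV'] := UU' V UV; exists V' => //; exact: subset_trans VV'.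
Qed.

End metric_metacompact.

(** * Countable compactness and increasing sequences *)

Local Open Scope order_scope.
Local Open Scope classical_set_scope.

(* The dual order carries the same topology, so every lemma about increasing
   sequences and left neighborhoods can be applied to [X^d]. *)
HB.instance Definition _ d (X : POrderedTopological.type d) :=
  Topological.copy X^d X.

Lemma countableU T (A B : set T) :
  countable A -> countable B -> countable (A `|` B).
Proof.
move=> cA cB; have -> : A `|` B = \bigcup_(i in [set: bool]) if i then A else B.
  apply/seteqP; split => x; first by case=> ?; [exists true|exists false].
  by case=> -[] _ ?; [left|right].
by apply: bigcup_countable => // -[].
Qed.

Lemma countable_image T U (f : T -> U) (A : set T) :
  countable A -> countable (f @` A).
Proof. exact/sub_countable/card_image_le. Qed.

Lemma finite_set_bound (T : eqType) (A : set T) (P : T -> nat -> Prop) :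
  finite_set A -> (forall a, A a -> exists n, P a n) ->
  exists m, forall a, A a -> exists2 n, (n <= m)%N & P a n.
Proof.
move=> /finite_seqP[s ->]; elim: s => [|a s IH] H; first by exists 0%N.
have [|m mH] := IH; first by move=> b bs; apply: H; rewrite /= inE bs orbT.
have [|n Pan] := H a; first by rewrite /= inE eqxx.
exists (maxn m n) => b /=; rewrite inE => /orP[/eqP->|/mH[k km Pbk]].
  by exists n => //; rewrite leq_maxr.
by exists k => //; rewrite (leq_trans km)// leq_maxl.
Qed.

Section countable_compactness.
Context {T : topologicalType}.
Implicit Types A B : set T.

Lemma countably_compactU A B :
  countably_compact A -> countably_compact B -> countably_compact (A `|` B).
Proof.
move=> cA cB U cU oU ABU.
have [|D DU AD] := cA U cU oU; first by move=> x Ax; apply: ABU; left.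
have [|E EU BE] := cB U cU oU; first by move=> x Bx; apply: ABU; right.
exists (D `|` E)%fset.
  by move=> W; rewrite in_fsetU => /orP[/DU|/EU].
move=> x [/AD[W WD Wx]|/BE[W WE Wx]]; exists W => //=;
  by rewrite /= in_fsetU ?WD ?WE ?orbT.
Qed.

Lemma countably_compactI A B :
  countably_compact A -> closed B -> countably_compact (A `&` B).
Proof.
move=> cA clB U cU oU BU.
have [|||D DU AD] := cA (U `|` [set ~` B]).
- exact: countableU (countable1 _).
- by move=> W [/oU//|->]; exact: closed_openC.
- move=> x Ax; have [Bx|nBx] := pselect (B x).
    by have [W UW Wx] := BU x (conj Ax Bx); exists W => //; left.
  by exists (~` B) => //; right.
exists (D `\ (~` B)%classic)%fset.
  move=> W; rewrite in_fsetD1 => /andP[WB /DU]; rewrite !in_setE => -[//|WE].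
  by rewrite WE eqxx in WB.
move=> x [Ax Bx]; have [W WD Wx] := AD x Ax; exists W => //=.
by rewrite in_fsetD1 WD andbT; apply/eqP => WB; move: Wx; rewrite WB.
Qed.

Lemma countably_compact_closed A B :
  countably_compact A -> closed B -> B `<=` A -> countably_compact B.
Proof. by move=> cA clB BA; rewrite -(setIidr BA); exact: countably_compactI. Qed.

Lemma countably_compact1 (x : T) : countably_compact [set x].
Proof.
move=> U cU oU xU; have [W UW Wx] := xU x erefl.
exists [fset W]%fset; first by move=> V; rewrite in_fset1 => /eqP->; rewrite in_setE.
by move=> _ ->; exists W => //=; rewrite in_fset1.
Qed.

End countable_compactness.

Section increasing.
Context {d : Order.disp_t} {X : POrderedTopological.type d}.
Implicit Types (s : nat -> X) (A C : set X).

Definition increasing s := forall n, s n < s n.+1.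

(** For an increasing [s] in a GO-space this is convergence to [x] from strictly below, since a
    convex neighborhood containing [s n] and [x] contains all points in between. *)
Definition left_limit s (x : X) := (forall n, s n < x) /\
  forall N, nbhs x N -> exists n, forall z, s n <= z -> z <= x -> N z.

Lemma increasing_lt s m n : increasing s -> (m < n)%N -> s m < s n.
Proof.
move=> si; elim: n => // n IH; rewrite ltnS leq_eqVlt => /orP[/eqP->//|/IH].
by move=> /lt_trans; apply.
Qed.

Lemma increasing_le s m n : increasing s -> (m <= n)%N -> s m <= s n.
Proof.
by move=> si; rewrite leq_eqVlt => /orP[/eqP->//|/(increasing_lt si)/ltW].
Qed.

Definition cofinal C A := forall a, A a -> exists2 c, C c & a <= c.

End increasing.

Section go_order.
Context {d : Order.disp_t} {X : POrderedTopological.type d}.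
Hypothesis goX : go_space X.
Implicit Types (s : nat -> X) (x y z a b : X).

Lemma go_comparable x y : x >=< y.
Proof. by case: goX => + _ _; apply. Qed.

Lemma go_leNgt x y : (x <= y) = ~~ (y < x).
Proof. exact/comparable_leNgt/go_comparable. Qed.

Lemma go_ltNge x y : (x < y) = ~~ (y <= x).
Proof. exact/comparable_ltNge/go_comparable. Qed.

Lemma go_dual : go_space (X^d).
Proof.
case: goX => [tot hX [B bB cB]]; split => //; first by move=> x y; exact: tot y x.
exists B => // C BC x y z Cx Cy xzy; apply: (cB C BC y x z) => //.
by rewrite andbC.
Qed.

Lemma go_convex x (N : set X) : nbhs x N ->
  exists O : set X, [/\ open O, O x, O `<=` N & order_convex O].
Proof.
case: goX => _ _ [B [Bo Bb] cB] /(Bb x)[O [BO Ox] ON].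
by exists O; split => //; [exact: Bo|exact: cB].
Qed.

(** Hausdorffness gives [x] a convex neighborhood missing [a], and such a set stays above [a].
    Together with the dual statement, the topology refines the order topology. *)
Lemma go_open_gt a : open [set x | a < x].
Proof.
rewrite openE => x /= ax; have [_ hX _] := goX.
move: (hX); rewrite open_hausdorff => /(_ a x).
case; first by rewrite lt_eqF.
move=> [A B] /= []; rewrite !inE => Aa Bx [oA oB AB0].
have /go_convex[O [oO Ox OB cO]] : nbhs x B by apply: open_nbhs_nbhs.
apply: (@filterS _ _ _ O); last by apply: open_nbhs_nbhs.
move=> z Oz /=; rewrite go_ltNge; apply/negP => za.
have Ba : B a by apply: OB; apply: (cO z x) => //; rewrite za ltW.
by have : (A `&` B) a by []; rewrite AB0.
Qed.

End go_order.

Section go_topology.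
Context {d : Order.disp_t} {X : POrderedTopological.type d}.
Hypothesis goX : go_space X.
Implicit Types (s : nat -> X) (x y z a b : X) (A : set X).

Lemma go_open_lt a : open [set x | x < a].
Proof. exact: (go_open_gt (go_dual goX) a). Qed.

Lemma go_closed_ge a : closed [set x | a <= x].
Proof.
rewrite -openC (_ : ~` _ = [set x | x < a]); first exact: go_open_lt.
by apply/seteqP; split => x /=; rewrite (go_ltNge goX); move/negP.
Qed.

Lemma go_closed_le a : closed [set x | x <= a].
Proof.
rewrite -openC (_ : ~` _ = [set x | a < x]); first exact: go_open_gt.
by apply/seteqP; split => x /=; rewrite (go_ltNge goX); move/negP.
Qed.

Lemma left_limit_le s x b : left_limit s x -> (forall n, s n <= b) -> x <= b.
Proof.
move=> [sx limsx] sb; rewrite (go_leNgt goX); apply/negP => bx.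
have [|n /(_ (s n) (lexx _) (ltW (sx n)))] := limsx [set z | b < z].
  by apply: open_nbhs_nbhs; split => //; exact: go_open_gt.
by rewrite /= (go_ltNge goX) sb.
Qed.

(** A point of [K] above the sequence and adherent to its range is a left limit by convexity. If
    there is none, [W], the complement of the closure of the range, and the rays below the terms
    cover [K], and a finite subcover misses a late term. *)
Lemma increasing_left_limit (K : set X) s :
  countably_compact K -> increasing s -> (forall n, K (s n)) ->
  exists2 x, K x & left_limit s x.
Proof.
move=> cK si sK.
pose W := (~` range s)°.
have [[x [Kx sx Wx]]|nx] := pselect (exists x, [/\ K x, forall n, s n < x & ~ W x]).
  exists x => //; split => // N /(go_convex goX)[O [oO Ox ON cO]].
  suff [n On] : exists n, O (s n).
    by exists n => z nz zx; apply: ON; apply: (cO (s n) x) => //; apply/andP.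
  apply: contrapT => nO; apply: Wx; rewrite /W /interior.
  apply: (filterS _ (open_nbhs_nbhs (conj oO Ox))) => z Oz [n _ nz].
  by apply: nO; exists n; rewrite nz.
have [|||D DU KD] := cK ([set W] `|` range (fun n => [set z | z < s n])).
- exact: countableU (countable1 _) (countable_image _ _).
- by move=> _ [->|[n _ <-]]; [exact: open_interior|exact: go_open_lt].
- move=> z Kz; have [sz|] := pselect (forall n, s n < z).
    exists W; first by left.
    by apply: contrapT => nWz; apply: nx; exists z.
  move=> /existsNP[n /negP]; rewrite -(go_leNgt goX) => zn.
  exists [set z | z < s n.+1]; first by right; exists n.+1.
  exact: le_lt_trans zn _.
have [||m mD] := @finite_set_bound _ [set` D]
    (fun V n => V = W \/ V = [set z | z < s n]).
- exact: finite_fset.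
- move=> V /DU; rewrite in_setE => -[->|[n _ <-]]; first by exists 0%N; left.
  by exists n; right.
have [V /= VD Vs] := KD (s m) (sK m).
have [n nm [VW|VE]] := mD _ VD.
  by exfalso; move: Vs; rewrite VW => /interior_subset; apply; exists m.
by move: Vs; rewrite VE/= => /lt_le_trans/(_ (increasing_le si nm)); rewrite ltxx.
Qed.

(** The term [s n.+1] is chosen above [s n] and above the element of [C] with code [n], if there is
    one. *)
Lemma countable_cofinal_sequence (C : set X) : countable C -> C !=set0 ->
  (forall c, C c -> exists2 c', C c' & c < c') ->
  exists s, [/\ increasing s, forall n, C (s n) & cofinal (range s) C].
Proof.
move=> cC [c0 Cc0] nomax.
have /countable_injP[e einj] := cC.
have step (p : nat * X) : {c' : X | C p.2 ->
    [/\ C c', p.2 < c' & forall c, C c -> e c = p.1 -> c <= c']}.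
  apply: cid; case: p => n c /=.
  have [Cc|nCc] := pselect (C c); last by exists c.
  have [[c1 [Cc1 e1]]|nc1] := pselect (exists c1, C c1 /\ e c1 = n); last first.
    have [c' Cc' cc'] := nomax c Cc; exists c' => _; split => // c2 Cc2 e2.
    by exfalso; apply: nc1; exists c2.
  have [m [/nomax[c' Cc' mc'] cm c1m]] : exists m, [/\ C m, c <= m & c1 <= m].
    by have /orP[cc1|c1c] := go_comparable goX c c1; [exists c1|exists c].
  exists c' => _; split => //; first exact: le_lt_trans mc'.
  move=> c2 Cc2 e2; have -> : c2 = c1 by apply: einj; rewrite ?in_setE// e1.
  by rewrite ltW// (le_lt_trans c1m).
pose s := fix s n := if n is m.+1 then projT1 (step (m, s m)) else c0.
have sC n : C (s n).
  by elim: n => //= n IH; case: (step _) => c' /= /(_ IH)[].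
exists s; split => //.
  by move=> n /=; case: (step _) => c' /= /(_ (sC n))[].
move=> c Cc; exists (s (e c).+1); first by exists (e c).+1.
by rewrite /=; case: (step _) => c' /= /(_ (sC _))[_ _]; apply.
Qed.

End go_topology.

(** * Monotone countable metacompactness in GO-spaces *)

Section reach.
Context {d : Order.disp_t} {X : POrderedTopological.type d}.
Hypothesis goX : go_space X.
Variable r : set (set X) -> set (set X).
Hypothesis rP : monotone_metacompactness_operator (@countable_open_cover X) r.
Implicit Types (s : nat -> X) (x y z a b g : X) (A : set X).

Definition two_rays a b : set (set X) :=
  [set [set z | z < b]] `|` [set [set z | a < z]].

Definition reach g a b :=
  exists2 V, r (two_rays a b) V & forall z, g <= z -> z <= a -> V z.

Lemma two_rays_cover a b : a < b -> countable_open_cover (two_rays a b).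
Proof.
move=> ab; split; last exact: countableU (countable1 _) (countable1 _).
split; first by move=> _ [->|->]; [exact: go_open_lt|exact: go_open_gt].
apply/seteqP; split => // z _; have [zb|bz] := boolP (z < b).
  by exists [set z | z < b] => //; left.
exists [set z | a < z]; first by right.
by rewrite /= (lt_le_trans ab)// (go_leNgt goX).
Qed.

Lemma two_rays_member a b : a < b ->
  exists V, [/\ r (two_rays a b) V, open V & V a].
Proof.
move=> ab; have [[oV cV] _ _] := rP.1 _ (two_rays_cover ab).
have : setT a by []; rewrite -cV => -[V rV Va].
by exists V; split => //; exact: oV.
Qed.

Lemma reach_refl a b : a < b -> reach a a b.
Proof.
move=> /two_rays_member[V [rV _ Va]]; exists V => // z az za.
by have -> : z = a by apply/le_anti/andP.
Qed.

Lemma reach_left_limit s x b :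
  left_limit s x -> x < b -> exists n, reach (s n) x b.
Proof.
move=> [_ sx] /two_rays_member[V [rV oV Vx]].
have [|n nV] := sx V; first exact: open_nbhs_nbhs.
by exists n, V.
Qed.

(** Lowering [a] and raising [b] enlarges both rays, so [two_rays a b] refines [two_rays a' b'] and
    [r] preserves this; the interval to be contained only gets shorter. *)
Lemma reach_mono g a b a' b' : g <= a' -> a' <= a -> a < b -> b <= b' ->
  reach g a b -> reach g a' b'.
Proof.
move=> ga' a'a ab bb' [V rV gaV].
have a'b' := le_lt_trans a'a (lt_le_trans ab bb').
have [|W rW VW] := rP.2 _ _ (two_rays_cover ab) (two_rays_cover a'b') _ _ rV.
  move=> _ [->|->].
    exists [set z | z < b']; first by left.
    by move=> z /= zb; exact: lt_le_trans bb'.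
  exists [set z | a' < z]; first by right.
  by move=> z /=; exact: le_lt_trans.
by exists W => // z gz za'; apply: VW; apply: gaV => //; exact: le_trans a'a.
Qed.

(* Along an infinite chain [s] of such steps, each [two_rays (s n) (s n.+1)]
   refines the cover by the rays [z < s n] and [g < z]. The members of the image
   of that cover absorbing the intervals from [g] to [s n] all contain [g], so
   they are finitely many and each of them lies below some [s m]. *)
Lemma no_reach_chain g A : A !=set0 -> (forall a, A a -> g <= a) ->
  ~ (forall a, A a -> exists2 b, A b & a < b /\ reach g a b).
Proof.
move=> [a0 Aa0] gA stepA.
have step a : {b | A a -> [/\ A b, a < b & reach g a b]}.
  apply: cid; have [/stepA[b Ab [ab gab]]|nAa] := pselect (A a).
    by exists b => _; split.
  by exists a => /nAa.
pose s := fix s n := if n is m.+1 then sval (step (s m)) else a0.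
have sS n : s n.+1 = sval (step (s n)) by [].
have sA n : A (s n).
  by elim: n => // n IH; rewrite sS; case: (step _) => c /= /(_ IH)[].
have si : increasing s.
  by move=> n; rewrite sS; case: (step _) => c /= /(_ (sA n))[].
have sr n : reach g (s n) (s n.+1).
  by rewrite sS; case: (step _) => c /= /(_ (sA n))[].
pose U := range (fun n => [set z | z < s n]) `|` [set [set z | g < z]].
have cU : countable_open_cover U.
  split; last exact: countableU (countable_image _ _) (countable1 _).
  split; first by move=> _ [[n _ <-]|->]; [exact: go_open_lt|exact: go_open_gt].
  apply/seteqP; split => // z _; have [zs|sz] := boolP (z < s 1).
    by exists [set z | z < s 1] => //; left; exists 1%N.
  exists [set z | g < z]; first by right.
  rewrite /= (le_lt_trans (gA _ (sA 0%N)))// (lt_le_trans (si 0%N))//.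
  by rewrite (go_leNgt goX).
have absorb n : exists W, [/\ r U W, W g & W (s n)].
  have [V rV gV] := sr n.
  have [|W rW VW] := rP.2 _ _ (two_rays_cover (si n)) cU _ _ rV.
    move=> _ [->|->].
      by exists [set z | z < s n.+1] => //; left; exists n.+1.
    exists [set z | g < z]; first by right.
    by move=> z /=; exact/le_lt_trans/gA.
  by exists W; split => //; apply: VW; apply: gV => //; exact: gA.
have [_ fU rU] := rP.1 _ cU.
have [W [rW Wg]|m Hm] :=
    finite_set_bound (P := fun W n => W `<=` [set z | z < s n]) (fU g).
  have [V UV WV] := rU _ rW; move: UV WV => [[n _ <-]|-> /(_ _ Wg)/=].
    by exists n.
  by rewrite ltxx.
have [W [rW Wg Wm]] := absorb m; have [n nm /(_ _ Wm)/=] := Hm W (conj rW Wg).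
by move=> /lt_le_trans/(_ (increasing_le si nm)); rewrite ltxx.
Qed.

End reach.

Section cofinality.
Context {d : Order.disp_t} {X : POrderedTopological.type d}.
Hypothesis goX : go_space X.
Hypothesis mcmX : monotonically_countably_metacompact X.
Implicit Types (s : nat -> X) (x y z a b g : X) (A : set X).

(** Otherwise countable subsets of [A] are strictly bounded in [A], and each [g] has a barrier [h]
    past which nothing is reached from [g]. Iterated barriers have a left limit [x]. An open member
    containing [x] reaches back to some [s n], although [x] lies past the barrier [s n.+1] of
    [s n]. *)
Lemma countable_cofinality A :
  (forall s b, increasing s -> (forall n, A (s n)) -> A b ->
     (forall n, s n <= b) -> exists2 x, A x & left_limit s x) ->
  exists C, [/\ countable C, C `<=` A & cofinal C A].
Proof.
move=> limA; apply: contrapT => noC.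
have bounded C : countable C -> C `<=` A ->
    exists2 a, A a & forall c, C c -> c < a.
  move=> cC CA; apply: contrapT => nb; apply: noC; exists C; split => // a Aa.
  apply: contrapT => na; apply: nb; exists a => // c Cc.
  by rewrite (go_ltNge goX); apply/negP => ac; apply: na; exists c.
have next a : A a -> exists2 b, A b & a < b.
  move=> Aa; have [||b Ab ab] := bounded [set a]; [exact: countable1| |].
    by move=> _ ->.
  by exists b => //; exact: ab.
have [r rP] := mcmX.
have barrier g : {h | A g -> [/\ A h, g < h &
    forall a b, A a -> A b -> h <= a -> a < b -> ~ reach r g a b]}.
  apply: cid; have [Ag|nAg] := pselect (A g); last by exists g.
  apply: contrapT => nh.
  (* If no [h] were a barrier, some [reach g a b] with [h <= a] would exist, [reach_mono] would
     lower [a] to [h], and the points of [A] above [g] would carry an endless chain. *)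
  apply: (no_reach_chain goX rP (g := g) (A := [set a | A a /\ g < a])).
  - by have [b Ab gb] := next g Ag; exists b.
  - by move=> a [_ /ltW].
  - move=> h [Ah gh]; apply: contrapT => nb; apply: nh; exists h => _; split => //.
    move=> a b Aa Ab ha ab gab; apply: nb; exists b.
      by split => //; exact: lt_trans gh (le_lt_trans ha ab).
    split; first exact: le_lt_trans ab.
    exact: (reach_mono goX rP (ltW gh) ha ab).
have [a0 Aa0 _] := bounded set0 (countable0 _) (@sub0set _ _).
pose s := fix s n := if n is m.+1 then sval (barrier (s m)) else a0.
have sS n : s n.+1 = sval (barrier (s n)) by [].
have sA n : A (s n).
  by elim: n => // n IH; rewrite sS; case: (barrier _) => c /= /(_ IH)[].
have si : increasing s.
  by move=> n; rewrite sS; case: (barrier _) => c /= /(_ (sA n))[].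
have [||b Ab sb] := bounded (range s).
- exact: countable_image.
- by move=> _ [n _ <-].
have [|x Ax sx] := limA s b si sA Ab.
  by move=> n; apply/ltW/sb; exists n.
have [c Ac xc] := next x Ax.
have [n] := reach_left_limit goX rP sx xc.
have : s n.+1 <= x by exact/ltW/(sx.1).
rewrite sS; case: (barrier _) => h /= /(_ (sA n))[_ _ nr] hx.
exact: nr Ax Ac hx xc.
Qed.

End cofinality.

Lemma countable_closure T (op : T -> T -> set T) (a : T) :
  (forall x y, countable (op x y)) ->
  exists D, [/\ countable D, D a & forall x y, D x -> D y -> op x y `<=` D].
Proof.
move=> cop.
pose D := fix D n := if n is m.+1
  then D m `|` \bigcup_(x in D m) \bigcup_(y in D m) op x y else [set a].
have cD n : countable (D n).
  elim: n => [|n IH]; first exact: countable1.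
  by apply: countableU => //; do 2![apply: bigcup_countable => // ? _].
have mD m n : (m <= n)%N -> D m `<=` D n.
  elim: n => [|n IH]; first by rewrite leqn0 => /eqP->.
  by rewrite leq_eqVlt => /orP[/eqP->//|/IH mn x /mn Dx]; left.
exists (\bigcup_n D n); split; first exact: bigcup_countable.
  by exists 0%N.
move=> x y [m _ Dx] [n _ Dy] z xyz; exists (maxn m n).+1 => //; right.
exists x; first by apply: mD Dx; exact: leq_maxl.
by exists y => //; apply: mD Dy; exact: leq_maxr.
Qed.

(** * Countable separating sets and one-sided neighborhoods *)

Section separating_set.
Context {d : Order.disp_t} {X : POrderedTopological.type d}.
Hypothesis goX : go_space X.
Hypothesis mcmX : monotonically_countably_metacompact X.
Implicit Types (s : nat -> X) (x y z a b g : X) (A D : set X).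

Definition segment a b := [set z | a <= z <= b].

(** Endpoints are allowed: at a jump from [u] to [v], one of these two points must belong to [D]. *)
Definition separates D a b := forall u v, a <= u -> u < v -> v <= b ->
  exists2 e, D e & u <= e <= v.

Lemma countable_coinitial A :
  (forall s b, (forall n, s n.+1 < s n) -> (forall n, A (s n)) -> A b ->
     (forall n, b <= s n) -> exists2 x, A x & left_limit (X := X^d) s x) ->
  exists C, [/\ countable C, C `<=` A & forall a, A a -> exists2 c, C c & c <= a].
Proof. exact: (countable_cofinality (go_dual goX) mcmX). Qed.

Lemma countable_separating a b : countably_compact (segment a b) -> a <= b ->
  exists D, countable D /\ separates D a b.
Proof.
move=> cab ab; have [r rP] := mcmX.
pose S g t := [set z | t < z <= b /\ reach r g t z].
have coS g t : exists C, g <= t -> a <= t -> [/\ countable C, C `<=` S g t &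
    forall z, S g t z -> exists2 c, C c & c <= z].
  have [[gt0 at0]|nt] := pselect (g <= t /\ a <= t); last first.
    by exists set0 => gt0 at0; exfalso; apply: nt.
  have [|C HC] := @countable_coinitial (S g t); last by exists C.
  move=> s e sd sS [/andP[te eb] ge] es.
  have [|x /andP[ax xb] sx] :=
      increasing_left_limit (go_dual goX) (K := segment a b) (s := s) cab sd.
    move=> n; have [/andP[tn nb] _] := sS n.
    by rewrite /segment/= nb andbT ltW// (le_lt_trans at0).
  (* By [reach_mono], [reach g t] passes to larger endpoints, so the limit [x], being at least [e],
     stays in [S g t]. *)
  have ex : e <= x by exact: (left_limit_le (go_dual goX) sx es).
  exists x => //; split; first by rewrite xb andbT (lt_le_trans te).
  exact: (reach_mono goX rP gt0 (lexx _) te ex).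
(* [D] is closed under taking coinitial subsets of the sets [S g t]; if it
   missed a segment [[u, v]], the steps available between points of [D] below
   [u] would produce an infinite chain. *)
pose op g t := if pselect (g <= t /\ a <= t) then sval (cid (coS g t)) else set0.
have opP g t : g <= t -> a <= t -> [/\ countable (op g t), op g t `<=` S g t &
    forall z, S g t z -> exists2 c, op g t c & c <= z].
  rewrite /op => gt0 at0; case: pselect => [?|nt]; last by exfalso; apply: nt.
  exact: (svalP (cid (coS g t)) gt0 at0).
have [|D [cD Da opD]] := countable_closure (op := op) a.
  move=> g t; rewrite /op; case: pselect => [[gt0 at0]|?]; last exact: countable0.
  by have [] := svalP (cid (coS g t)) gt0 at0.
exists D; split => // u v au uv vb; apply: contrapT => nD.
have Dlt e : D e -> e <= v -> e < u.
  move=> De ev; rewrite (go_ltNge goX); apply/negP => ue.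
  by apply: nD; exists e => //; rewrite ue.
pose L := [set e | [/\ D e, a <= e & e < u]].
have LD e : L e -> D e by case.
(* The step up to [v] is shortened to end at some [t'] in [D] with [t' <= v]; as [D] misses the
   segment from [u] to [v], this [t'] falls below [u]. *)
have jump g t : L g -> L t -> g <= t -> reach r g t v ->
    exists2 t', L t' & t < t' /\ reach r g t t'.
  move=> [Dg ag gu] [Dt at0 tu] gt0 rv; have [_ sS coSgt] := opP g t gt0 at0.
  have [|t' ot' t'v] := coSgt v; first by split => //; rewrite (lt_trans tu).
  have [/andP[tt' _] rt'] := sS _ ot'.
  exists t'; last by split.
  split; [exact: opD ot'|by rewrite (le_trans at0)// ltW|].
  by apply: Dlt => //; exact: opD ot'.
have La : L a.
  split => //; rewrite lt_neqAle au andbT; apply/negP => /eqP ua.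
  by apply: nD; exists a => //; rewrite ua lexx ltW// -ua.
have cL : countable L by apply: sub_countable cD; exact: subset_card_le.
have nomax c : L c -> exists2 c', L c' & c < c'.
  move=> Lc; have [_ _ cu] := Lc.
  have [|c' Lc' [cc' _]] := jump c c Lc Lc (lexx c); last by exists c'.
  exact: (reach_refl goX rP (lt_trans cu uv)).
have [s [si sL sco]] := countable_cofinal_sequence goX cL (ex_intro _ a La) nomax.
have [|x /andP[ax xb] sx] := increasing_left_limit goX cab si.
  move=> n; have [_ an nu] := sL n.
  by rewrite /segment/= an ltW// (lt_le_trans (lt_trans nu uv)).
have xu : x <= u.
  by apply: (left_limit_le goX sx) => n; have [_ _ /ltW] := sL n.
(* From [s n] on, lowering [x] to any [t] of [L] keeps a step from [t] up to [v], so [jump] can be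
   repeated without end. *)
have [n rn] := reach_left_limit goX rP sx (le_lt_trans xu uv).
apply: (no_reach_chain goX rP (g := s n) (A := [set t | L t /\ s n <= t])).
- by exists (s n); split.
- by move=> t [].
- move=> t [Lt nt]; have [_ [m _ <-] tm] := sco t Lt.
  have tx := le_lt_trans tm (sx.1 m).
  have [|t' Lt' [tt' rt']] := jump (s n) t (sL n) Lt nt.
    exact: (reach_mono goX rP nt (ltW tx) (le_lt_trans xu uv) (lexx _) rn).
  by exists t' => //; split => //; rewrite (le_trans nt)// ltW.
Qed.

(* [a, x) has countable cofinality; if it has no maximum, countable compactness
   makes [x] the left limit of a cofinal sequence. *)
Lemma left_neighborhood a x D (N : set X) : a < x ->
  countably_compact (segment a x) -> separates D a x -> nbhs x N ->
  (exists e, [/\ D e, e < x & forall z, e < z -> z <= x -> N z]) \/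
  D x /\ open [set z | x <= z].
Proof.
move=> ax cax sD xN.
have [s b si sA /andP[ab bx] sb|C [cC CA coC]] :=
    countable_cofinality goX mcmX (A := [set z | a <= z < x]).
  have [|y /andP[ay yx] sy] := increasing_left_limit goX cax si.
    by move=> n; have /andP[an /ltW nx] := sA n; rewrite /segment/= an.
  by exists y => //=; rewrite ay (le_lt_trans (left_limit_le goX sy sb)).
have [[m Cm mmax]|nomax] := pselect (exists2 m, C m & forall c, C c -> ~ m < c).
  have /andP[am mx] := CA _ Cm.
  (* Here [m] is the immediate predecessor of [x], so the point [e] of [D] found in this jump is
     either [m], giving the first alternative, or [x], giving the second. *)
  have gap z : m < z -> x <= z.
    move=> mz; rewrite (go_leNgt goX); apply/negP => zx.
    have [|c Cc zc] := coC z; first by rewrite /= zx ltW// (le_lt_trans am).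
    exact: mmax Cc (lt_le_trans mz zc).
  have [e De /andP[me ex]] := sD m x am mx (lexx x).
  have [/gap xe|] := boolP (m < e); last first.
    rewrite -(go_leNgt goX) => em; left; exists e; split => //.
      exact: le_lt_trans mx.
    move=> z ez zx; have -> : z = x.
      by apply/le_anti/andP; split => //; apply: gap; exact: le_lt_trans ez.
    exact: nbhs_singleton xN.
  right; have <- : e = x by apply/le_anti/andP.
  split => //; rewrite (_ : [set z | _] = [set z | m < z]); first exact: go_open_gt.
  apply/seteqP; split => z /=; last by move=> /gap; exact: le_trans.
  exact: lt_le_trans (lt_le_trans mx xe).
have [||s [si sC sco]] := countable_cofinal_sequence goX cC.
- by have [|c Cc _] := coC a; [rewrite /= lexx|exists c].
- move=> c Cc; apply: contrapT => nc; apply: nomax; exists c => // c' Cc' cc'.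
  by apply: nc; exists c'.
have sA n : a <= s n < x by exact: CA.
have [|y /andP[ay yx] sy] := increasing_left_limit goX cax si.
  by move=> n; have /andP[an /ltW nx] := sA n; rewrite /segment/= an.
have ynx : ~ y < x.
  move=> yx'; have [|c Cc yc] := coC y; first by rewrite /= ay.
  have [_ [n _ <-] cn] := sco c Cc.
  by have := le_lt_trans (le_trans yc cn) (sy.1 n); rewrite ltxx.
have {ynx}yE : y = x.
  by apply/le_anti; rewrite yx (go_leNgt goX); apply/negP.
rewrite {}yE {ay yx} in sy; have [n nN] := sy.2 N xN.
have /andP[an _] := sA n.
have [e De /andP[ne en]] := sD _ _ an (si n) (ltW (sy.1 n.+1)).
left; exists e; split => //; first exact: le_lt_trans en (sy.1 n.+1).
by move=> z ez zx; apply: nN => //; exact: le_trans ne (ltW ez).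
Qed.

End separating_set.

(** * Components *)

Section upper_rays.
Context {d : Order.disp_t} {X : POrderedTopological.type d}.
Implicit Types (x : X) (C D N : set X).

(** These contain the left halves of a base on [C]: [C] itself serves a least point of [C], and a
    closed ray serves a point [x] of [D] for which [[set z | x <= z]] is open. Other closed rays
    need not be open. *)
Definition upper_rays C D : set (set X) := [set C] `|`
  ((fun e => C `&` [set z | e < z]) @` D `|` (fun e => C `&` [set z | e <= z]) @` D).

Lemma upper_rays_countable C D : countable D -> countable (upper_rays C D).
Proof.
move=> cD; apply: countableU; first exact: countable1.
by apply: countableU; exact: countable_image.
Qed.

Lemma upper_rays_nbhs C D x N : go_space X ->
  monotonically_countably_metacompact X -> open C -> C x ->
  (forall a, C a -> a < x -> countably_compact (segment a x) /\ separates D a x) ->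
  nbhs x N ->
  exists A, [/\ upper_rays C D A, open A, A x & forall z, A z -> z <= x -> N z].
Proof.
move=> goX mcmX oC Cx CD xN.
have [[a Ca ax]|nCx] := pselect (exists2 a, C a & a < x); last first.
  exists C; split => //; first by left.
  move=> z Cz zx; have -> : z = x; last exact: nbhs_singleton xN.
  by apply/le_anti; rewrite zx (go_leNgt goX); apply/negP => xz; apply: nCx; exists z.
have [cax sD] := CD a Ca ax.
have [[e [De ex eN]]|[Dx ox]] := left_neighborhood goX mcmX ax cax sD xN.
  exists (C `&` [set z | e < z]); split => //.
  - by right; left; exists e.
  - by apply: openI => //; exact: go_open_gt.
  - by move=> z [_ ez]; exact: eN.
exists (C `&` [set z | x <= z]); split => //.
- by right; right; exists x.
- exact: openI.
- by split => //=.
move=> z [_ xz] zx; have -> : z = x; last exact: nbhs_singleton xN.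
by apply/le_anti/andP.
Qed.

End upper_rays.

Section hull_def.
Context {d : Order.disp_t} {X : POrderedTopological.type d}.
Implicit Types (x y p : X).

(** Unless [x = y], at most one of the two segments is nonempty, so no case distinction on the order
    is made. *)
Definition hull x y := segment x y `|` segment y x.

Definition component p := [set y | countably_compact (hull p y)].

End hull_def.

Section duality.
Context {d : Order.disp_t} {X : POrderedTopological.type d}.
Implicit Types (x y p : X).

Lemma segment_dual x y : segment (X := X^d) x y = segment y x.
Proof. by apply/seteqP; split => z; rewrite /segment/= andbC. Qed.

Lemma hull_dual x y : hull (X := X^d) x y = hull x y.
Proof. by rewrite /hull !segment_dual setUC. Qed.

Lemma component_dual p : component (X := X^d) p = component p.
Proof. by apply/seteqP; split => z; rewrite /component/= hull_dual. Qed.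

End duality.

Section hull.
Context {d : Order.disp_t} {X : POrderedTopological.type d}.
Hypothesis goX : go_space X.
Implicit Types (x y z a b p : X) (C D N : set X).

Lemma closed_segment x y : closed (segment x y).
Proof.
rewrite (_ : segment x y = [set z | x <= z] `&` [set z | z <= y]).
  by apply: closedI; [exact: go_closed_ge|exact: go_closed_le].
by apply/seteqP; split => z /andP.
Qed.

Lemma closed_hull x y : closed (hull x y).
Proof. by apply: closedU; exact: closed_segment. Qed.

Lemma hull_trans x y z : hull x z `<=` hull x y `|` hull y z.
Proof.
move=> w; rewrite /hull/segment/= => -[/andP[h1 h2]|/andP[h1 h2]].
  have /orP[h|h] := go_comparable goX w y.
    by left; left; rewrite h1.
  by right; left; rewrite h h2.
have /orP[h|h] := go_comparable goX w y.
  by right; right; rewrite h1 h.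
by left; right; rewrite h h2.
Qed.

Lemma hull_sub x y w : hull x y w -> hull x w `<=` hull x y.
Proof.
move=> xyw z; move: xyw; rewrite /hull/segment/=.
move=> [/andP[xw wy]|/andP[yw wx]] [/andP[h1 h2]|/andP[h1 h2]].
- by left; rewrite h1 (le_trans h2).
- by left; rewrite (le_trans xw)// (le_trans h2)// (le_trans xw).
- by right; rewrite (le_trans yw)/= ?(le_trans h2)// (le_trans wx).
- by right; rewrite h2 (le_trans yw).
Qed.

Lemma component_refl x : component x x.
Proof.
rewrite /component/= (_ : hull x x = [set x]); first exact: countably_compact1.
apply/seteqP; split => z; rewrite /hull/segment/=.
  by move=> [] /andP[xz zx]; apply/le_anti/andP.
by move=> ->; left; rewrite lexx.
Qed.

Lemma component_sym x y : component x y -> component y x.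
Proof. by rewrite /component/= /hull setUC. Qed.

Lemma component_trans x y z : component x y -> component y z -> component x z.
Proof.
move=> xy yz; apply: (countably_compact_closed (countably_compactU xy yz)).
  exact: closed_hull.
exact: hull_trans.
Qed.

Lemma component_eq x y : component x y -> component x = component y.
Proof.
move=> xy; apply/seteqP; split => z; first exact/component_trans/component_sym.
exact: component_trans.
Qed.

Lemma component_convex p x w : component p x -> hull p x w -> component p w.
Proof.
move=> px pxw; apply: (countably_compact_closed px); first exact: closed_hull.
exact: hull_sub.
Qed.

Lemma component_segment p a b :
  component p a -> component p b -> countably_compact (segment a b).
Proof.
move=> pa pb; have ab := component_trans (component_sym pa) pb.
by apply: (countably_compact_closed ab); [exact: closed_segment|move=> z; left].
Qed.

Lemma component_between p a b w : component p a -> component p b ->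
  a <= w -> w <= b -> component p w.
Proof.
move=> pa pb aw wb; apply: (component_trans pa).
apply: (component_convex (component_trans (component_sym pa) pb)).
by left; apply/andP.
Qed.

Hypothesis lccX : locally_countably_compact X.

(** A convex neighborhood of [x] inside a countably compact set contains the hull of [x] and each of
    its points, and hulls are closed. *)
Lemma open_component p : open (component p).
Proof.
rewrite openE => x px; have [K xK cK] := lccX x.
have [O [oO Ox OK cO]] := go_convex goX xK.
apply: (filterS _ (open_nbhs_nbhs (conj oO Ox))) => y Oy.
apply: (component_trans px); apply: (countably_compact_closed cK).
  exact: closed_hull.
by move=> z [?|?]; apply: OK; [exact: (cO x y)|exact: (cO y x)].
Qed.

Lemma closed_component p : closed (component p).
Proof.
rewrite -openC (_ : ~` _ = \bigcup_(x in ~` component p) component x).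
  by apply: bigcup_open => x _; exact: open_component.
apply/seteqP; split => x; first by move=> npx; exists x => //; exact: component_refl.
by move=> [y npy yx] px; apply: npy; exact/(component_trans px)/component_sym.
Qed.

Hypothesis mcmX : monotonically_countably_metacompact X.

(** Bounded increasing sequences in the part of the class above [p] converge there, so this part has
    a countable cofinal set [C]. The separating sets of the segments from [p] to the points of [C]
    are united. *)
Lemma component_separating_above p : exists D, countable D /\
  forall u v, p <= u -> u < v -> component p v -> exists2 e, D e & u <= e <= v.
Proof.
have [s b si sA [pb cb] sb|C [cC CA coC]] := countable_cofinality goX mcmX
    (A := [set z | p <= z /\ component p z]).
  have cpb : countably_compact (segment p b).
    by apply: component_segment cb; exact: component_refl.
  have [|y /andP[py yb] sy] := increasing_left_limit goX cpb si.
    by move=> n; have [pn _] := sA n; rewrite /segment/= pn sb.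
  by exists y => //; split => //; apply: (component_convex cb); left; apply/andP.
have sep c : exists D, C c -> countable D /\ separates D p c.
  have [Cc|nCc] := pselect (C c); last by exists set0.
  have [pc cc] := CA c Cc.
  have [|D HD] := countable_separating goX mcmX (a := p) (b := c) _ pc.
    by apply: component_segment cc; exact: component_refl.
  by exists D.
have {}sep c := cid (sep c).
exists (\bigcup_(c in C) sval (sep c)); split.
  by apply: bigcup_countable => // c Cc; have [] := svalP (sep c) Cc.
move=> u v pu uv cv; have [|c Cc vc] := coC v.
  by split => //; rewrite (le_trans pu)// ltW.
by have [e De uev] := (svalP (sep c) Cc).2 u v pu uv vc; exists e => //; exists c.
Qed.

End hull.

Definition base_of (T : topologicalType) (C : set T) (B : set (set T)) :=
  [/\ countable B, B `<=` open &
  forall x N, C x -> nbhs x N -> exists O, [/\ B O, O x & O `<=` N]].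

(** * Second countability of the components *)

Section second_countability.
Context {d : Order.disp_t} {X : POrderedTopological.type d}.
Hypothesis goX : go_space X.
Hypothesis lccX : locally_countably_compact X.
Hypothesis mcmX : monotonically_countably_metacompact X.
Implicit Types (x y z a b p : X) (C D N : set X).

Lemma component_separating p : exists2 D, countable D &
  forall u v, component p u -> component p v -> separates D u v.
Proof.
have [D [cD sD]] := component_separating_above goX mcmX p.
have [E [cE sE]] := component_separating_above (go_dual goX) mcmX p.
(* The point [p] serves the segments that contain it; [D] serves those above [p] and [E] those
   below. *)
exists ([set p] `|` (D `|` E)).
  by do 2!apply: countableU => //; exact: countable1.
move=> a b pa pb u v au uv vb.
have pu : component p u.
  by apply: component_between pa pb au _; rewrite // (le_trans (ltW uv)).
have pv : component p v.
  by apply: component_between pa pb _ vb; rewrite // (le_trans au)// ltW.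
have /orP[pu'|up] := go_comparable goX p u.
  by have [e De uev] := sD u v pu' uv pv; exists e => //; right; left.
have /orP[pv'|vp] := go_comparable goX p v.
  by exists p; [left|rewrite up].
have [|e Ee veu] := sE v u vp uv; first by rewrite component_dual.
by exists e; [right; right|rewrite andbC].
Qed.

(** An upper ray controls the points to the left of [x] and a lower ray those to the right, so their
    intersection lies in [N]. *)
Lemma component_countable_base p : exists B, base_of (component p) B.
Proof.
have [D cD sD] := component_separating p.
pose C := component p.
pose lower := upper_rays (X := X^d) C D.
exists ((fun AB => AB.1 `&` AB.2) @` (upper_rays C D `*` lower) `&` open); split.
- apply: sub_countable (subset_card_le (@subIsetl _ _ _)) _.
  by apply/countable_image/countableX; exact: upper_rays_countable.
- exact: subIsetr.
move=> x N px xN; have oC := open_component goX lccX p.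
have [|A [rA oA Ax AN]] := upper_rays_nbhs (D := D) goX mcmX oC px _ xN.
  move=> a pa ax; split; first exact: component_segment pa px.
  exact: sD.
have [|B [rB oB Bx BN]] :=
    upper_rays_nbhs (X := X^d) (D := D) (go_dual goX) mcmX oC px _ xN.
  move=> b pb xb; split; first by rewrite segment_dual; exact: component_segment px pb.
  move=> v u vb uv xu; have [e De /andP[ue ev]] := sD x b px pb u v xu uv vb.
  by exists e => //; apply/andP.
exists (A `&` B); split => //.
  by split; [exists (A, B)|exact: openI].
move=> z [Az Bz]; have /orP[zx|xz] := go_comparable goX z x; first exact: AN.
exact: BN.
Qed.

End second_countability.

(** * Metrization *)

Local Open Scope ring_scope.
Local Open Scope classical_set_scope.

Section metrization.
Context {R : realType} {T : topologicalType}.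
Implicit Types (x y z : T) (N K O : set T) (B : set (set T)).

(** If [F] has no cluster point in [K], each point of [K] lies in a member of [B] whose complement
    belongs to [F]. These members are countably many, and a finite subcover puts the empty set in
    [F]. *)
Lemma countably_compact_compact C B K : base_of C B -> K `<=` C ->
  countably_compact K -> compact K.
Proof.
move=> [cB oB CB] KC cK F PF FK; apply: contrapT => ncl.
have [|||E EB KE] := cK [set O | B O /\ F (~` O)].
- by apply: sub_countable cB; apply: subset_card_le => O [].
- by move=> O [/oB].
- move=> x Kx; apply: contrapT => nx; apply: ncl; exists x; split => // A N FA xN.
  have [O [BO Ox ON]] := CB x N (KC x Kx) xN.
  apply: contrapT => AN; apply: nx; exists O => //; split => //.
  by apply: filterS FA => y Ay Oy; apply: AN; exists y; split => //; exact: ON.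
have : F (K `&` \bigcap_(O in [set` E]) ~` O).
  apply: filterI => //; apply: filter_bigI => O OE.
  by have := EB _ OE; rewrite in_setE => -[].
by move=> /filter_ex[x [/KE[O OE Ox] /(_ O OE)]].
Qed.

(* The functions are indexed by the pairs [(O1, O2)] of members of the base
   for which some continuous [f] is small on [O1] and equal to 1 off [O2]. *)
Lemma countable_separating_functions C B :
  @completely_regular_space T -> base_of C B ->
  exists f : nat -> T -> R, [/\ forall n, continuous (f n),
    forall n x, 0 <= f n x <= 1 &
    forall x N, C x -> nbhs x N ->
      exists n, f n x < 2^-1 /\ forall y, ~ N y -> f n y = 1].
Proof.
move=> crT [cB oB CB].
pose good (O : set T * set T) (f : T -> R) := [/\ continuous f,
  forall x, 0 <= f x <= 1, forall x, O.1 x -> f x < 2^-1 &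
  forall x, ~ O.2 x -> f x = 1].
have /countable_injP[e einj] : countable (B `*` B) by exact: countableX.
have fn n : {f : T -> R | [/\ continuous f, forall x, 0 <= f x <= 1 &
    forall Q f', (B `*` B) Q -> e Q = n -> good Q f' -> good Q f]}.
  apply: cid; have [[Q [f [BQ eQ gf]]]|nQ] :=
    pselect (exists Q f, [/\ (B `*` B) Q, e Q = n & good Q f]).
    exists f; have [cf f01 _ _] := gf; split => // Q' f' BQ' eQ' _.
    by have -> : Q' = Q by apply: einj; rewrite ?in_setE// eQ.
  exists (fun=> 0); split; first exact: cst_continuous.
    by move=> _; rewrite lexx ler01.
  by move=> Q f' BQ eQ gf; exfalso; apply: nQ; exists Q, f'.
exists (fun n => sval (fn n)); split.
- by move=> n; have [] := svalP (fn n).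
- by move=> n; have [] := svalP (fn n).
move=> x N Cx xN; have [O2 [BO2 O2x O2N]] := CB x N Cx xN.
have /(@uniform_separatorP _ R)[f [cf f01 f0 f1]] :
    uniform_separator [set x] (~` O2).
  by apply: crT; [exact/open_closedC/oB|exact].
have fx : f x = 0 by apply: f0; exists x.
(* A bound on all of [O1], instead of the value 0 at [x], lets one function serve every point of
   [O1], so countably many suffice. *)
have [|O1 [BO1 O1x O1f]] := CB x (f @^-1` [set t | t < 2^-1]) Cx.
  apply: cf; rewrite fx; apply: open_nbhs_nbhs; split; first exact: open_lt.
  by rewrite /= invr_gt0.
have gf : good (O1, O2) f.
  split => //.
  - by move=> y; have := f01 (f y); rewrite /= in_itv/=; apply; exists y.
  - by move=> y nO2; apply: f1; exists y.
have [_ _ /(_ (O1, O2) f (conj BO1 BO2) erefl gf)[_ _ s1 s2]] :=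
  svalP (fn (e (O1, O2))).
exists (e (O1, O2)); split; first exact: s1.
by move=> y nNy; apply: s2 => /O2N.
Qed.

(** The distance is the supremum of the weighted differences [tau n], set to 1 between different
    classes. As [f] is indexed by the set [C x], the points of a class share their functions, which
    makes [tau] symmetric. *)
Lemma metrizable_components (C : T -> set T) (f : set T -> nat -> T -> R) :
  hausdorff_space T ->
  (forall x, open (C x)) -> (forall x, C x x) ->
  (forall x y, C x y -> C x = C y) ->
  (forall x n, continuous (f (C x) n)) ->
  (forall x n y, 0 <= f (C x) n y <= 1) ->
  (forall x N, nbhs x N -> exists n, f (C x) n x < 2^-1 /\
     forall y, ~ N y -> f (C x) n y = 1) ->
  metrizable R T.
Proof.
move=> hT oC Cxx CE cf f01 sepf.
pose w n : R := n.+1%:R^-1.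
have w0 n : 0 < w n by rewrite invr_gt0.
have w1 n : w n <= 1 by rewrite invf_le1// ler1n.
pose tau n x y := if pselect (C x y) then w n * `|f (C x) n x - f (C x) n y| else 1.
have tauE n x y : C x y -> tau n x y = w n * `|f (C x) n x - f (C x) n y|.
  by rewrite /tau; case: pselect.
have tauN n x y : ~ C x y -> tau n x y = 1.
  by rewrite /tau; case: pselect.
have Csym x y : C x y -> C y x by move=> /CE <-; exact: Cxx.
have tau_ge0 n x y : 0 <= tau n x y.
  have [Cxy|nC] := pselect (C x y); last by rewrite tauN.
  by rewrite tauE// mulr_ge0// ltW.
have dist1 n x y : `|f (C x) n x - f (C x) n y| <= 1.
  by have := f01 x n x; have := f01 x n y; rewrite ler_norml; lra.
have tau_w n x y : C x y -> tau n x y <= w n.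
  by move=> Cxy; rewrite tauE// ler_piMr// ltW.
have tau_le1 n x y : tau n x y <= 1.
  have [Cxy|nC] := pselect (C x y); last by rewrite tauN.
  exact: le_trans (tau_w _ _ _ Cxy) _.
have tauC n x y : tau n x y = tau n y x.
  have [Cxy|nC] := pselect (C x y); last by rewrite !tauN// => /Csym.
  by rewrite !tauE//; [rewrite (CE _ _ Cxy) distrC|exact: Csym].
have tau_triangle n x y z : tau n x z <= tau n x y + tau n y z.
  have [Cxy|nxy] := pselect (C x y); last first.
    by rewrite (tauN _ _ _ nxy) (le_trans (tau_le1 _ _ _))// lerDl.
  have [Cyz|nyz] := pselect (C y z); last first.
    by rewrite (tauN _ _ _ nyz) (le_trans (tau_le1 _ _ _))// lerDr.
  have Cxz : C x z by rewrite (CE _ _ Cxy).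
  rewrite !tauE// -(CE _ _ Cxy) -mulrDr (ler_wpM2l (ltW (w0 n)))//.
  exact: ler_distD.
pose S x y := range (fun n => tau n x y).
have S1 x y : has_ubound (S x y) by exists 1 => _ [n _ <-].
have S0 x y : S x y !=set0 by exists (tau 0%N x y), 0%N.
have le_rho n x y : tau n x y <= sup (S x y) by apply: ub_le_sup => //; exists n.
have rho_le x y e : (forall n, tau n x y <= e) -> sup (S x y) <= e.
  by move=> le_e; apply: ge_sup => // _ [n _ <-].
exists (fun x y => sup (S x y)); first split.
- move=> x; apply/le_anti; rewrite (le_trans (tau_ge0 0%N x x)) ?andbT//.
  by apply: rho_le => n; rewrite tauE// subrr normr0 mulr0.
- move=> x y rho0; apply: hT => A B xA yB.
  have tau0 n : tau n x y = 0.
    by apply/le_anti; rewrite tau_ge0 andbT -rho0.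
  exists y; split; last exact: nbhs_singleton.
  have Cxy : C x y.
    apply: contrapT => nC; have /eqP := tau0 0%N.
    by rewrite tauN// oner_eq0.
  have [n [fx fN]] := sepf x A xA; apply: contrapT => nAy.
  have /eqP := tau0 n; rewrite tauE// mulf_eq0 gt_eqF//= normr_eq0 subr_eq0.
  by rewrite (fN y nAy) => /eqP fx1; move: fx; rewrite fx1; lra.
- by move=> x y; congr sup; apply/seteqP; split => _ [n _ <-]; exists n; rewrite // tauC.
- move=> y x z; apply: rho_le => n.
  by rewrite (le_trans (tau_triangle n x y z))// lerD.
move=> x; apply/seteqP; split => N.
  move=> xN; have [n [fx fN]] := sepf x N xN.
  (* Off [N] but in the class, the function differs by more than 1/2 from its value at [x]; off the
     class [tau] is 1. Both put [tau n x y] above this radius. *)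
  exists (w n * 2^-1); first by rewrite /= mulr_gt0// invr_gt0.
  move=> y /= rho_lt; apply: contrapT => nNy.
  have /(le_lt_trans (le_rho n x y)) := rho_lt.
  have [Cxy|nC] := pselect (C x y); last first.
    by rewrite tauN//; have := w1 n; have := w0 n; lra.
  rewrite tauE// ltr_pM2l// (fN y nNy) distrC ger0_norm; first by lra.
  by have := f01 x n x; lra.
move=> [e /= e0 eN]; apply: filterS eN _.
(* The supremum inherits only a weak bound, hence [e / 2]. Indices below [m] are controlled by
   continuity, the others by their weight. *)
have e20 : 0 < e / 2 by rewrite divr_gt0.
have [m wm] : exists m, w m < e / 2.
  exists (Num.truncn (e / 2)^-1); rewrite /w invf_plt ?posrE//.
  by rewrite truncnS_gt.
have near_x k : nbhs x [set y | forall n, (n < k)%N ->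
    `|f (C x) n x - f (C x) n y| < e / 2].
  elim: k => [|k IH]; first by apply: filterS filterT => y _ n.
  have nk : nbhs x [set y | `|f (C x) k x - f (C x) k y| < e / 2].
    exact: (cf x k x _ (nbhsx_ballx (f (C x) k x) _ e20)).
  apply: filterS (filterI IH nk) => y [Hy ky] n.
  by rewrite ltnS leq_eqVlt => /orP[/eqP->|/Hy].
have nC : nbhs x (C x) by apply: open_nbhs_nbhs.
apply: filterS (filterI nC (near_x m)) => y [Cxy Hy] /=.
apply: (@le_lt_trans _ _ (e / 2)); last by rewrite ltr_pdivrMr// ltr_pMr// ltr1n.
apply: rho_le => n; have [nm|mn] := ltnP n m.
  by rewrite tauE// (le_trans _ (ltW (Hy n nm)))// ler_piMl.
rewrite (le_trans (tau_w _ _ _ Cxy))// (le_trans _ (ltW wm))//.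
by rewrite lef_pV2 ?posrE// ler_nat.
Qed.

End metrization.

(** * The two equivalences *)

Section characterization.
Context {R : realType} {d : Order.disp_t} {X : POrderedTopological.type d}.

Lemma metrizable_monotonically_metacompact :
  metrizable R X -> monotonically_metacompact X.
Proof.
by move=> [rho mrho nrho]; exact: (metric_monotonically_metacompact mrho nrho).
Qed.

Lemma monotonically_metacompact_countably :
  monotonically_metacompact X -> monotonically_countably_metacompact X.
Proof.
move=> [r [rP rmono]]; exists r; split; first by move=> U [oU _]; exact: rP.
by move=> U V [oU _] [oV _]; exact: rmono.
Qed.

Lemma monotonically_countably_metacompact_metrizable :
  go_space X -> locally_countably_compact X ->
  monotonically_countably_metacompact X -> metrizable R X.
Proof.
move=> goX lccX mcmX; have hX : hausdorff_space X by case: goX.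
have base (p : X) : exists B, base_of (component p) B.
  exact: (component_countable_base goX lccX mcmX p).
(* A countably compact neighborhood of [x], cut down to the component of [x], is compact because the
   component has a countable base; so the space is locally compact and Hausdorff. *)
have crX : @completely_regular_space X.
  apply: (@locally_compact_completely_regular X R) => // x _.
  have [K xK cK] := lccX x; have [B baseB] := base x.
  have cKx : compact (K `&` component x).
    apply: (countably_compact_compact baseB); first exact: subIsetr.
    exact/countably_compactI/closed_component.
  exists (K `&` component x); last by split => //; exact: compact_closed.
  apply: (@filterS _ (nbhs x) _ (K `&` component x)) => [y Ky _|]; first by [].
  apply: filterI => //; apply: open_nbhs_nbhs.
  by split; [exact: open_component|exact: component_refl].
(* Choosing by the set [C] makes the family constant on each component; sets that are not components
   get zero functions. *)
have sepf (C : set X) : {f : nat -> X -> R | forall p, C = component p ->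
    [/\ forall n, continuous (f n), forall n x, 0 <= f n x <= 1 &
      forall x N, C x -> nbhs x N ->
        exists n, f n x < 2^-1 /\ forall y, ~ N y -> f n y = 1]}.
  apply: cid; have [[p ->]|nC] := pselect (exists p, C = component p).
    have [B /(countable_separating_functions (R := R) crX)[f Hf]] := base p.
    by exists f.
  by exists (fun _ _ => 0) => p Cp; exfalso; apply: nC; exists p.
apply: (@metrizable_components R X component (fun C => sval (sepf C))) => //.
- exact: open_component.
- exact: component_refl.
- exact: component_eq.
- by move=> x n; have [] := svalP (sepf (component x)) x erefl.
- by move=> x n y; have [] := svalP (sepf (component x)) x erefl.
- move=> x N xN; have [_ _ H] := svalP (sepf (component x)) x erefl.
  by apply: H => //; exact: component_refl.
Qed.

End characterization.

Theorem corollary3p7 (R : realType) (d : Order.disp_t)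
    (X : POrderedTopological.type d) :
  go_space X ->
  locally_countably_compact X ->
  (monotonically_metacompact X <-> metrizable R X) /\
  (monotonically_countably_metacompact X <-> metrizable R X).
Proof.
move=> goX lccX.
have cm := @monotonically_metacompact_countably d X.
have mm := @metrizable_monotonically_metacompact R d X.
have mz := @monotonically_countably_metacompact_metrizable R d X goX lccX.
by split; split => [|/mm]; [move/cm/mz|by []|exact: mz|exact: cm].
Qed.
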